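(* Let $h:[0,1]\to\mathbb{R}$ be a twice continuously differentiable, non-negative, concave function with bounded second derivative. Then for every $\epsilon>0$ there exist $g\in\mathbb{N}$ and $\boldsymbol{\theta}\in\tilde{\Theta}_{g+1}$ such that the polygonal approximation $f(\cdot;\boldsymbol{\theta})$ satisfies $$\sup_{x\in[0,1]}|h(x)-f(x;\boldsymbol{\theta})|<\epsilon.$$ That is, the class of polygonal approximations is dense, in the supremum norm, within the class of twice continuously differentiable, non-negative, concave functions with bounded second derivative on the unit interval.
   Context: Write $[m]=\{1,\dots,m\}$. For $\theta\in(0,1)$ the triangular density on $[0,1]$ is $f(x;\theta)=2x/\theta$ if $x<\theta$ and $f(x;\theta)=2(1-x)/(1-\theta)$ if $x\ge\theta$; moreover $f(x;0)=2(1-x)$ and $f(x;1)=2x$. For $m\in\mathbb{N}$ let $$\tilde\Theta_m=\{\boldsymbol{\theta}^\top=(\pi_1,\dots,\pi_m,\theta_1,\dots,\theta_m):\pi_i\ge0,\ \theta_i\in[0,1],\ i\in[m]\}$$ (the weights need not sum to one). A polygonal approximation with $m$ components is a function $f(x;\boldsymbol{\theta})=\sum_{i=1}^m\pi_i f(x;\theta_i)$, $x\in[0,1]$, with $\boldsymbol{\theta}\in\tilde\Theta_m$. *)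

(* Defs.v *)
From mathcomp Require Import all_boot all_order all_algebra.
From mathcomp Require Import all_classical all_reals all_analysis.

Set Implicit Arguments.
Unset Strict Implicit.
Unset Printing Implicit Defensive.
Import Order.TTheory GRing.Theory Num.Theory.
Import numFieldNormedType.Exports.

Local Open Scope classical_set_scope.
Local Open Scope ring_scope.

(* The limit of the difference quotient is taken along [D] only, so that at an
   endpoint of [`[0, 1]] this is the one-sided derivative and the values of [f]
   outside [D] play no role. *)
Definition is_deriv_on (R : realType) (D : set R) (f f' : R -> R) : Prop :=
  forall x, D x ->
    (f y - f x) / (y - x) @[y --> within D x^'] --> f' x.

(* The library's convexity is stated for the regular module [R^o]. *)
Definition concave_on (R : realType) (D : set R) (f : R -> R) : Prop :=
  @convex_function R R^o D (fun x => - f x).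

(* The case [t = 1] is separate because the general formula would give
   [2 * (1 - x) / 0 = 0] at [x = 1]. *)
Definition triangular (R : realType) (t x : R) : R :=
  if t == 0 then 2 * (1 - x)
  else if t == 1 then 2 * x
  else if x < t then 2 * x / t
  else 2 * (1 - x) / (1 - t).

(* Parameters are column vectors [(pi_1, ..., pi_m, theta_1, ..., theta_m)]^T:
   weights in the upper half, modes in the lower half. *)
Definition weight (R : realType) (m : nat) (th : 'cV[R]_(m + m)) (i : 'I_m) : R :=
  usubmx th i 0.

Definition mode (R : realType) (m : nat) (th : 'cV[R]_(m + m)) (i : 'I_m) : R :=
  dsubmx th i 0.

Definition Theta_tilde (R : realType) (m : nat) : set 'cV[R]_(m + m) :=
  [set th | forall i : 'I_m, 0 <= weight th i /\ mode th i \in `[0, 1]].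

Definition polygonal (R : realType) (m : nat) (th : 'cV[R]_(m + m)) (x : R) : R :=
  \sum_(i < m) weight th i * triangular (mode th i) x.

(* Main.v *)
(* A function with a derivative at each point of the compact interval [0, 1] is
   uniformly continuous there, hence uniformly close to its piecewise linear
   interpolant at the nodes k / n for n large.  The interpolant is
     h 0 * (1 - x) + h 1 * x + \sum_k n * d k * hat (k / n) x,
   where hat t x = min ((1 - t) * x) (t * (1 - x)) is the Green function of the
   second derivative on [0, 1] and - d k is the second difference of h at k / n,
   so d k >= 0 by concavity.  As hat t = t * (1 - t) / 2 * triangular t, this is
   a polygonal approximation. *)
Require Import Defs.
From mathcomp Require Import all_boot all_order all_algebra.
From mathcomp Require Import all_classical all_reals all_analysis.
From mathcomp Require Import ring lra.
Import Order.TTheory GRing.Theory Num.Theory.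
Import numFieldNormedType.Exports.
Local Open Scope classical_set_scope.
Local Open Scope ring_scope.

(** * Uniform continuity on a compact set *)

(** Near [x] the difference quotient is bounded by [|f' x| + 1], so a radius of [e / (|f' x| + 1)]
    suffices. *)
Lemma is_deriv_on_near {R : realType} {D : set R} {f f' : R -> R} {x : R} (e : R) :
  is_deriv_on D f f' -> D x -> 0 < e ->
  \forall y \near x, D y -> `|f y - f x| < e.
Proof.
move=> df Dx e0.
have /cvgrPdist_lt /(_ 1 ltr01) := df x Dx.
rewrite !near_withinE => dfx.
have B0 : 0 < `|f' x| + 1 by rewrite ltr_wpDl.
have r0 : 0 < e / (`|f' x| + 1) by rewrite divr_gt0.
near=> y => Dy.
have [->|yx] := eqVneq y x; first by rewrite subrr normr0.
have q1 : `|f' x - (f y - f x) / (y - x)| < 1 by move: yx Dy; near: y.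
have xy : `|x - y| < e / (`|f' x| + 1).
  by near: y; apply: nbhsx_ballx.
have yx0 : 0 < `|y - x| by rewrite normr_gt0 subr_eq0.
have qB : `|(f y - f x) / (y - x)| < `|f' x| + 1.
  have := ler_normB (f' x) (f' x - (f y - f x) / (y - x)).
  by rewrite subKr; lra.
rewrite -[f y - f x](@divfK _ (y - x)) ?subr_eq0// normrM.
rewrite distrC ltr_pdivlMr// in xy.
by apply: le_lt_trans xy; rewrite [leRHS]mulrC ler_wpM2r// ltW.
Unshelve. all: by end_near. Qed.

Lemma is_deriv_on_unif_continuous {R : realType} {K : set R} {f f' : R -> R}
    (e : R) : compact K -> is_deriv_on K f f' -> 0 < e ->
  exists2 d : R, 0 < d &
    forall x y, K x -> K y -> `|y - x| < d -> `|f y - f x| < e.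
Proof.
move=> cK df e0.
have /near_covering_withinP cvr := (compact_near_coveringP K).1 cK.
pose P (d x : R) := forall y, K y -> `|y - x| < d -> `|f y - f x| < e.
(* The near-covering form of compactness replaces a finite subcover: it is enough to treat [x']
   close to a fixed [x] and all small [d]. Halving the radius [r] keeps both [x'] and [y] in the
   ball around [x]. *)
have : \forall d \near 0^'+, K `<=` P d.
  apply: cvr => x Kx.
  have e2 : 0 < e / 2 by rewrite divr_gt0.
  have /nbhs_ballP[r /= r0 fr] := is_deriv_on_near (e / 2) df Kx e2.
  have r2 : 0 < r / 2 by rewrite divr_gt0.
  near=> x' d.
  move=> /= Kx' y Ky yx'.
  have x'x : `|x - x'| < r / 2 by near: x'; apply: nbhsx_ballx.
  have dr : d < r / 2 by near: d; apply: nbhs_right_lt.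
  have h1 : `|f x' - f x| < e / 2 by apply: fr => //; rewrite /ball/=; lra.
  have h2 : `|f y - f x| < e / 2.
    by apply: fr => //; rewrite /ball/=; have := ler_distD x' x y;
      rewrite (distrC x' y); lra.
  by have := ler_distD (f x) (f y) (f x'); rewrite (distrC (f x) (f x')); lra.
move=> HP.
have [d [d0 Pd]] : exists d : R, 0 < d /\ K `<=` P d.
  near (0 : R)^'+ => d; exists d; split; last by near: d.
  by near: d; apply: nbhs_right_gt.
by exists d => // x y Kx; apply: Pd.
Unshelve. all: by end_near. Qed.

(** * Hat functions and their second differences *)

Definition hat {R : realType} (t x : R) : R :=
  if x < t then (1 - t) * x else t * (1 - x).

Lemma hat_lel {R : realType} (t x : R) : x <= t -> hat t x = (1 - t) * x.
Proof. by rewrite le_eqVlt /hat; case: ltP => // + /orP[/eqP|//]; lra. Qed.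

Lemma hat_ler {R : realType} (t x : R) : t <= x -> hat t x = t * (1 - x).
Proof. by rewrite /hat; case: ltP. Qed.

(** For [t = 0] and [t = 1] both sides vanish, so the two boundary modes cannot be recovered from
    hats. *)
Lemma hat_triangular {R : realType} (t x : R) : 0 <= x <= 1 ->
  t * (1 - t) / 2 * triangular t x = hat t x.
Proof.
move=> x01; rewrite /triangular /hat.
have [->|t0] := eqVneq t 0; first by case: ltP; lra.
have [->|t1] := eqVneq t 1; first by case: ltP; nra.
by case: ltP => _; field => //; rewrite subr_eq0 eq_sym.
Qed.

Lemma hat_affine {R : realType} (t a b s : R) : 0 <= s <= 1 -> a <= b ->
  t <= a \/ b <= t ->
  hat t ((1 - s) * a + s * b) = (1 - s) * hat t a + s * hat t b.
Proof.
move=> s01 ab [ta|bt].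
- by rewrite !hat_ler; [ring|nra..].
- by rewrite !hat_lel; [ring|nra..].
Qed.

(** Uniqueness for the discrete Dirichlet problem: zero second differences and [u 0 = 0] force
    [u j = j * u 1], and then [u n = 0] forces [u 1 = 0]. *)
Lemma second_difference_eq0 {R : realType} (u : nat -> R) (n : nat) :
  (0 < n)%N -> u 0%N = 0 -> u n = 0 ->
  (forall j, (j.+2 <= n)%N -> u j.+2 - 2 * u j.+1 + u j = 0) ->
  forall j, (j <= n)%N -> u j = 0.
Proof.
move=> n0 u0 un u2.
have uE j : (j.+1 <= n)%N -> u j = j%:R * u 1%N /\ u j.+1 = j.+1%:R * u 1%N.
  elim: j => [_|j IH jn]; first by rewrite u0 mul0r mul1r.
  have [uj uj1] := IH (ltnW jn); split => //.
  by have := u2 j jn; rewrite uj uj1 -(@natr1 _ j.+1) -(@natr1 _ j); lra.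
have u1 : u 1%N = 0.
  have [_] := uE n.-1 ltac:(by rewrite prednK).
  rewrite prednK// un => /esym/eqP; rewrite mulf_eq0 pnatr_eq0.
  by rewrite -leqn0 leqNgt n0 => /eqP.
by case=> // j /uE[_ ->]; rewrite u1 mulr0.
Qed.

Definition node {R : realType} (n k : nat) : R := k%:R / n%:R.

Lemma ler_node {R : realType} (n j k : nat) : (j <= k)%N ->
  node n j <= node n k :> R.
Proof. by move=> jk; rewrite ler_wpM2r ?invr_ge0// ler_nat. Qed.

Lemma nodeS {R : realType} (n k : nat) : node n k.+1 = node n k + n%:R^-1 :> R.
Proof. by rewrite /node -natr1 mulrDl mul1r. Qed.

Lemma node_itv {R : realType} (n k : nat) : (0 < n)%N -> (k <= n)%N ->
  0 <= (node n k : R) <= 1.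
Proof.
by move=> n0 kn; rewrite divr_ge0//= ler_pdivrMr ?ltr0n// mul1r ler_nat.
Qed.

(** The hat is affine on each side of its kink, where the slope drops from [1 - t] to [- t]; three
    consecutive nodes detect this drop only when the kink is the middle one. *)
Lemma hat_second_difference {R : realType} (n j k : nat) : (0 < n)%N ->
  n%:R * (hat (node n k) (node n j.+2) - 2 * hat (node n k) (node n j.+1)
          + hat (node n k) (node n j)) = - (k == j.+1)%:R :> R.
Proof.
move=> n0; have nz : n%:R != 0 :> R by rewrite pnatr_eq0 -lt0n.
have [kj|kj|->] := ltngtP k j.+1.
- rewrite !hat_ler ?ler_node//; first by rewrite !nodeS/=; ring.
  + exact: ltnW.
  + by rewrite ltnW// ltnW.
- rewrite !hat_lel ?ler_node//; first by rewrite !nodeS/=; ring.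
  + by rewrite ltnW// ltnW.
  + exact: ltnW.
- rewrite (hat_ler _ (node n j.+2)) ?ler_node// !hat_lel ?ler_node//.
  by rewrite !nodeS/=; field.
Qed.

(** * The piecewise linear interpolant *)

Definition concavity {R : realType} (a : nat -> R) (k : nat) : R :=
  2 * a k - a k.+1 - a k.-1.

(** The sum runs over all [n.+1] nodes to match the list of modes. At [k = 0] and [k = n], where
    [concavity] is not a genuine second difference on the grid, the hat vanishes on the unit
    interval. *)
Definition interpolant {R : realType} (a : nat -> R) (n : nat) (x : R) : R :=
  a 0%N * (1 - x) + a n * x
  + \sum_(k < n.+1) n%:R * concavity a k * hat (node n k) x.

Lemma hat_node0 {R : realType} (n k : nat) : hat (node n k) 0 = 0 :> R.
Proof. by rewrite hat_lel ?mulr0// divr_ge0. Qed.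

Lemma hat_node1 {R : realType} (n k : nat) : (0 < n)%N -> (k <= n)%N ->
  hat (node n k) 1 = 0 :> R.
Proof.
by move=> n0 kn; rewrite hat_ler ?subrr ?mulr0//; case/andP: (@node_itv R n k n0 kn).
Qed.

Lemma node0 {R : realType} (n : nat) : node n 0 = 0 :> R.
Proof. exact: mul0r. Qed.

Lemma nodenn {R : realType} (n : nat) : (0 < n)%N -> node n n = 1 :> R.
Proof. by move=> n0; rewrite /node divff// pnatr_eq0 -lt0n. Qed.

(** The interpolant and [a] have the same end values and, by [hat_second_difference], the same
    second differences at inner nodes. *)
Lemma interpolant_node {R : realType} (a : nat -> R) (n j : nat) :
  (0 < n)%N -> (j <= n)%N -> interpolant a n (node n j) = a j.
Proof.
move=> n0 jn; apply/eqP; rewrite -subr_eq0; apply/eqP; move: j jn.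
apply: (@second_difference_eq0 R (fun j => _ - a j)) => //.
- rewrite /interpolant node0 big1 => [|k _]; last by rewrite hat_node0 mulr0.
  by ring.
- rewrite /interpolant nodenn// big1 => [|k _]; first by ring.
  by rewrite hat_node1 ?mulr0// -ltnS.
- move=> j jn; rewrite /interpolant.
  set S := fun i : nat => \sum_(k < n.+1) n%:R * concavity a k * hat (node n k) (node n i).
  have SE : S j.+2 - 2 * S j.+1 + S j = - concavity a j.+1.
    rewrite /S mulr_sumr -sumrB -big_split/=.
    have jn1 : (j.+1 < n.+1)%N by rewrite ltnS ltnW.
    rewrite (bigD1 (Ordinal jn1))//= big1 ?addr0 => [|k kj].
      transitivity (concavity a j.+1 * - (j.+1 == j.+1)%:R); last first.
        by rewrite eqxx mulrN1.
      by rewrite -(hat_second_difference n)//; ring.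
    transitivity (concavity a k * - (k == j.+1 :> nat)%:R); last first.
      by rewrite (_ : (_ == _ :> nat) = false) ?mulrN ?mulr0 ?oppr0//; apply/negbTE.
    by rewrite -(hat_second_difference n)//; ring.
  rewrite -!/(S _) !nodeS; move: SE; rewrite /concavity/=.
  by move: (S _) (S _) (S _) => ? ? ?; lra.
Qed.

(** No kink lies strictly between consecutive nodes, so every hat is affine on the cell. *)
Lemma interpolant_affine {R : realType} (a : nat -> R) (n j : nat) (s : R) :
  (0 < n)%N -> (j < n)%N -> 0 <= s <= 1 ->
  interpolant a n ((1 - s) * node n j + s * node n j.+1)
    = (1 - s) * a j + s * a j.+1.
Proof.
move=> n0 jn s01.
have <- := interpolant_node a n j n0 (ltnW jn).
have <- := interpolant_node a n j.+1 n0 jn.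
rewrite /interpolant.
have hatE k : hat (node n k) ((1 - s) * node n j + s * node n j.+1)
    = (1 - s) * hat (node n k) (node n j) + s * hat (node n k) (node n j.+1).
  apply: hat_affine => //; first exact: ler_node.
  by case: (leqP k j) => kj; [left|right]; exact: ler_node.
under eq_bigr do
  rewrite hatE mulrDr [X in X + _]mulrCA [X in _ + X]mulrCA.
by rewrite big_split/= -!mulr_sumr; ring.
Qed.

Lemma node_cell {R : realType} (n : nat) (x : R) : (0 < n)%N -> 0 <= x <= 1 ->
  exists j s, [/\ (j < n)%N, 0 <= s <= 1 &
    x = (1 - s) * node n j + s * node n j.+1].
Proof.
move=> n0 /andP[x0 x1]; have nR : 0 < n%:R :> R by rewrite ltr0n.
have [j [jn jx]] : exists j, (j < n)%N /\ j%:R <= n%:R * x <= j.+1%:R.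
  (* At [x = 1] truncating [n * x] would give [n], which starts no cell; the last cell is taken
     instead. *)
  move: x1; rewrite le_eqVlt => /orP[/eqP->|x1].
    exists n.-1; rewrite prednK// mulr1 lexx andbT; split=> //.
    by rewrite ler_nat leq_pred.
  have nx0 : 0 <= n%:R * x by rewrite mulr_ge0.
  have /andP[t1 t2] := truncn_itv nx0.
  exists (Num.truncn (n%:R * x)); rewrite t1 ltW//; split=> //.
  rewrite -(@ltr_nat R); apply: le_lt_trans t1 _.
  by rewrite -[ltRHS]mulr1 ltr_pM2l.
exists j, (n%:R * x - j%:R); split=> //.
  by move: jx; rewrite -natr1; lra.
by rewrite /node -natr1; field; rewrite gt_eqF.
Qed.

(** On a cell the interpolant is a convex combination of the values of [h] at the two end nodes,
    each within [n%:R^-1] of [x]. *)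
Lemma dist_interpolant {R : realType} (h : R -> R) (n : nat) (e : R) :
  (0 < n)%N ->
  (forall x y, 0 <= x <= 1 -> 0 <= y <= 1 -> `|y - x| <= n%:R^-1 ->
     `|h y - h x| <= e) ->
  forall x, 0 <= x <= 1 -> `|h x - interpolant (h \o node n) n x| <= e.
Proof.
move=> n0 he x x01; have [j [s [jn s01 xE]]] := node_cell n x n0 x01.
have ni : 0 <= n%:R^-1 :> R by rewrite invr_ge0.
have hj : `|h x - h (node n j)| <= e.
  apply: he => //; first by rewrite node_itv// ltnW.
  by rewrite xE nodeS ler_norml; nra.
have hj1 : `|h x - h (node n j.+1)| <= e.
  apply: he => //; first by rewrite node_itv.
  by rewrite xE nodeS ler_norml; nra.
rewrite [in interpolant _ _ _]xE interpolant_affine//=.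
by move: hj hj1; rewrite !ler_norml; nra.
Qed.

(** * Concavity and non-negative weights *)

Lemma concave_on_midpoint {R : realType} (D : set R) (f : R -> R) (x y : R) :
  concave_on D f -> D x -> D y -> f x + f y <= 2 * f ((x + y) / 2).
Proof.
move=> cf Dx Dy.
(* The convexity coefficient is an element of a bundled interval type, so [2^-1] has to be packaged
   with its bounds. *)
have h01 : Itv.spec (@Itv.num_sem R) (Itv.Real `[0%Z, 1%Z]) (2^-1 : R).
  by rewrite /= /Itv.num_sem/= num_real/= in_itv/=; lra.
have -> : (x + y) / 2 = 2^-1 * x + (1 - 2^-1) * y by field.
have : - f (2^-1 * x + (1 - 2^-1) * y) <= 2^-1 * - f x + (1 - 2^-1) * - f y.
  exact: cf (Itv.mk h01) x y (mem_set Dx) (mem_set Dy).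
by lra.
Qed.

Lemma interpolant_polygonal {R : realType} (a : nat -> R) (n : nat) :
  (0 < n)%N -> 0 <= a 0%N -> 0 <= a n ->
  (forall k, (0 < k < n)%N -> 0 <= concavity a k) ->
  exists th : 'cV[R]_(n.+1 + n.+1), Theta_tilde th /\
    forall x, 0 <= x <= 1 -> polygonal th x = interpolant a n x.
Proof.
move=> n0 a0 an ak.
(* The last summand is the factor from [hat_triangular]. The first two produce the affine part,
   since the modes [0] and [1] have densities [2 * (1 - x)] and [2 * x]. *)
pose w k : R := (k == 0%N)%:R * (a 0%N / 2) + (k == n)%:R * (a n / 2)
  + n%:R * concavity a k * (node n k * (1 - node n k) / 2).
pose th := col_mx (\col_(i < n.+1) w i) (\col_(i < n.+1) (node n i : R)).
have wE i : weight th i = w i by rewrite /weight col_mxKu mxE.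
have mE i : mode th i = node n i by rewrite /mode col_mxKd mxE.
exists th; split=> [i|x x01].
  have i_n : (i <= n)%N by rewrite -ltnS.
  have /andP[t0 t1] := @node_itv R n i n0 i_n.
  rewrite mE in_itv/= t0 t1 wE; split=> //.
  rewrite addr_ge0//; first by rewrite addr_ge0// mulr_ge0// divr_ge0.
  (* At the two end nodes [concavity] has no known sign, but its factor [t * (1 - t)] is zero. *)
  have [->|i0] := posnP i; first by rewrite node0 !mul0r mulr0.
  have [->|i1] := eqVneq (i : nat) n.
    by rewrite nodenn// subrr mulr0 mul0r mulr0.
  rewrite mulr_ge0//; last by rewrite divr_ge0// mulr_ge0// subr_ge0.
  by rewrite mulr_ge0// ak// i0 ltn_neqAle i1.
rewrite /polygonal /interpolant.
under eq_bigr => i _.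
  rewrite wE mE mulrDl -mulrA hat_triangular// mulrDl; over.
rewrite !big_split/=; congr (_ + _ + _).
- rewrite (bigD1 ord0)//= big1 ?addr0 => [|i i0].
    by rewrite node0 /triangular eqxx; field.
  by rewrite (_ : (_ == _ :> nat) = false) ?mul0r//; apply/negbTE.
- rewrite (bigD1 ord_max)//= big1 ?addr0 => [|i i0].
    by rewrite nodenn// /triangular eqxx oner_eq0 !eqxx/=; field.
  by rewrite (_ : (_ == _ :> nat) = false) ?mul0r//; apply/negbTE.
Qed.

Theorem theorem2 (R : realType) (h h' h'' : R -> R)
  (h_deriv : is_deriv_on `[0, 1] h h')
  (h'_deriv : is_deriv_on `[0, 1] h' h'')
  (h''_continuous : {within `[0, 1], continuous h''})
  (h_ge0 : forall x : R, x \in `[0, 1] -> 0 <= h x)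
  (h_concave : concave_on `[0, 1] h)
  (h''_bounded : [bounded h'' x | x in `[0, 1]])
  (eps : R) (eps_gt0 : 0 < eps) :
  exists (g : nat) (th : 'cV[R]_(g.+1 + g.+1)),
    [/\ (0 < g)%N,
        Theta_tilde th &
        (ereal_sup [set (`|h x - polygonal th x|)%:E | x in `[0%R, 1%R]]
           < eps%:E)%E].
Proof.
have e2 : 0 < eps / 2 by rewrite divr_gt0.
have [d d0 hd] :=
  is_deriv_on_unif_continuous (eps / 2) (@segment_compact R 0 1) h_deriv e2.
(* The successor makes [n] exceed [d^-1] strictly, so the mesh is finer than [d]. *)
pose n := (Num.truncn d^-1).+1.
have nd : n%:R^-1 < d.
  rewrite -[ltRHS]invrK ltf_pV2 ?posrE ?invr_gt0 ?ltr0n//.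
  by have /andP[] := truncn_itv (ltW (eqbRL (invr_gt0 d) d0)).
have nodeI k : (k <= n)%N -> (node n k : R) \in `[0, 1].
  by move=> kn; rewrite in_itv/= node_itv.
have [||k /andP[k0 kn]|th [Tth thE]] := @interpolant_polygonal R (h \o node n) n isT.
- exact/h_ge0/nodeI.
- exact/h_ge0/nodeI.
- have :=
    concave_on_midpoint `[0, 1] h (node n k.-1) (node n k.+1) h_concave
    (nodeI _ (leq_trans (leq_pred k) (ltnW kn))) (nodeI _ kn).
  rewrite (_ : (_ + _) / 2 = node n k); first by rewrite /concavity/=; lra.
  by rewrite -{2 3}(prednK k0) !nodeS; field; rewrite pnatr_eq0.
exists n, th; split=> //.
(* A supremum preserves only weak bounds; working with [eps / 2] restores the strict one. *)
apply: (@le_lt_trans _ _ (eps / 2)%:E); last by rewrite lte_fin; lra.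
apply: ge_ereal_sup => _ [x /= x01 <-]; rewrite in_itv/= in x01.
rewrite lee_fin thE//; apply: dist_interpolant => // {x01}x y x01 y01 yx.
by apply/ltW/hd; rewrite /= ?in_itv//=; apply: le_lt_trans nd.
Qed.
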